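(* Let $d \ge 1$ and $t \ge 2$ be integers. There exists a numerical semigroup $S$ of embedding dimension three with $\Delta(S) = \{d, td\}$ if and only if $t = 2$.
   Context: $\mathbb{N} = \{0,1,2,\ldots\}$. A numerical semigroup is an additive submonoid $S$ of $\mathbb{N}$ with finite complement. Every numerical semigroup has a unique minimal generating set $\{n_1,\ldots,n_e\}$ (positive integers); $e$ is called the embedding dimension of $S$. All factorizations are taken with respect to the minimal generating set. A factorization of $y \in S$ is a tuple $(a_1,\ldots,a_e) \in \mathbb{N}^e$ with $a_1 n_1 + \cdots + a_e n_e = y$; its length is $a_1+\cdots+a_e$. Let $\mathcal{L}(y) = \{\ell_1 < \ell_2 < \cdots < \ell_m\}$ be the (finite) set of lengths of factorizations of $y$. The delta set of $y$ is $\Delta(y) = \{\ell_{i+1}-\ell_i : 1 \le i \le m-1\}$, and the delta set of $S$ is $\Delta(S) = \bigcup_{y \in S} \Delta(y)$. *)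

(* Defs.v *)
From mathcomp Require Import all_boot.
From mathcomp Require Import classical_sets cardinality.

Set Implicit Arguments.
Unset Strict Implicit.
Unset Printing Implicit Defensive.

Local Open Scope classical_set_scope.
Local Open Scope nat_scope.

Definition submonoid (M : set nat) : Prop :=
  M 0 /\ forall x y, M x -> M y -> M (x + y).

Definition numerical_semigroup (S : set nat) : Prop :=
  submonoid S /\ finite_set (~` S).

Definition generates (A S : set nat) : Prop := smallest submonoid A = S.

(* The elements of A need not be required to be positive: 0 is always a
   redundant generator, so it belongs to no minimal generating set. *)
Definition minimal_generating_set (A S : set nat) : Prop :=
  generates A S /\ forall B : set nat, B `<=` A -> generates B S -> B = A.

(* The minimal generating set of S, listed in increasing order
   n_1 < ... < n_e; the ordering makes the list n unique. *)
Definition minimal_generators (S : set nat) (n : seq nat) : Prop :=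
  sorted ltn n /\ minimal_generating_set [set` n] S.

Definition embedding_dimension (S : set nat) (e : nat) : Prop :=
  exists2 n : seq nat, minimal_generators S n & size n = e.

Definition factorizations (n : seq nat) (y : nat) : set ((size n).-tuple nat) :=
  [set a | \sum_(i < size n) tnth a i * nth 0 n i = y].
Arguments factorizations : clear implicits.

Definition lengths (n : seq nat) (y : nat) : set nat :=
  [set \sum_(i < size n) tnth a i | a in factorizations n y].

(* Differences of consecutive elements of L. *)
Definition gaps (L : set nat) : set nat :=
  [set k | exists l l', [/\ L l, L l', l < l',
                            forall m, L m -> ~~ (l < m < l') & k = l' - l]].

(* Quantifying over n only names the list of minimal generators of S, which
   exists and is unique when S is a numerical semigroup. *)
Definition delta_set (S : set nat) : set nat :=
  [set k | exists2 n, minimal_generators S n &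
           exists2 y, S y & gaps (lengths n y) k].

(* Main.v *)
Require Import Defs.
From mathcomp Require Import all_boot order ssralg ssrnum ssrint intdiv zify.
From mathcomp Require Import boolp classical_sets cardinality.

(** Write the minimal generators as n1 < n2 < n3 and let M be the rank-two
    lattice of integer relations x1 n1 + x2 n2 + x3 n3 = 0, with the length
    functional x1 + x2 + x3.

    Suppose that the delta set is {d, td} with t >= 2.  Let c1 n1 be the least
    multiple of n1 in <n2, n3>, equal to r12 n2 + r13 n3 with r12 + r13 as large
    as possible, and let c3 n3 be the least multiple of n3 in <n1, n2>, equal to
    r31 n1 + r32 n2 with r31 + r32 as small as possible.  These relations
    v1 = (c1, -r12, -r13) and v3 = (r31, r32, -c3) have positive lengths, and
    both lengths are elements of the delta set
    ([longest_relation_gap], [shortest_relation_gap]).  By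
    [relations_dichotomy] there are two cases.

    - v1 <> v3.  The triangle (0, v1, v3) contains no relation besides its
      vertices, so v1 and v3 form a basis of M ([relations_basis]).  If their
      lengths agree, this length is the only gap ([equal_relation_gaps]), although
      d <> td.  Otherwise the lengths are d and td, and (r12 + r32) n2 shows that
      their difference (t - 1)d is a gap as well ([middle_gap]); it is not td, so
      it is d.

    - v1 = v3 = (c1, 0, -c3).  Every gap is at most c1 - c3
      ([coincident_gap_le]), so td = c1 - c3.  As d is not a multiple of c1 - c3,
      the least multiple c2 n2 of n2 in <n1, n3> gives an element c1 n1 + c2 n2
      with exactly one length strictly between c3 + c2 and c1 + c2
      ([coincident_gap_split]): it cuts td into two gaps, both equal to d.

    Either way t = 2.  Conversely, for pairwise coprime c1 > c2 > c3 > 1 the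
    semigroup <c2 c3, c1 c3, c1 c2> has all its relations generated by
    exchanges of c1 copies of the first generator, c2 copies of the second and
    c3 copies of the third.  Its gaps are bounded by the larger of c1 - c2 and
    c2 - c3 ([coprime_triple_gap_le]), are divisible by their common divisors
    ([coprime_triple_gap_dvd]), and include both of them
    ([coprime_triple_gaps]); (c1, c2, c3) = (6d + 1, 4d + 1, 3d + 1) yields
    the delta set {d, 2d}. *)

Set Implicit Arguments.
Unset Strict Implicit.
Unset Printing Implicit Defensive.

Import Order.TTheory GRing.Theory Num.Theory.

Local Open Scope classical_set_scope.
Local Open Scope nat_scope.

(** * Minimal generators and gaps *)

Section Atoms.

Variable S : set nat.

Definition atom : set nat :=
  [set x | [/\ S x, x != 0 & forall y z, S y -> S z -> x = y + z ->
                                         y = 0 \/ z = 0]].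

Lemma generates_submonoid A : generates A S -> submonoid S.
Proof.
move=> <-; split; first by move=> M [[]].
move=> x y Mx My M MA; case: (MA) => -[_ addM] _.
by apply: addM; [exact: Mx | exact: My].
Qed.

Lemma generates_subset A : generates A S -> A `<=` S.
Proof. by move=> <- x Ax M [_]; exact. Qed.

(** Removing an atom from [S] leaves a submonoid, so a generating set that missed
    the atom could not reach it. *)
Lemma atom_in_generating A x : generates A S -> atom x -> A x.
Proof.
move=> genA [Sx x_neq0 x_irr]; apply: contrapT => nAx.
have [S0 SD] := generates_submonoid genA.
have subA := generates_subset genA.
have genx : smallest submonoid A x by rewrite genA.
suff /(genx (S `\ x)) [_] : submonoid (S `\ x) /\ A `<=` S `\ x.
  by apply.
split; last first.
  by move=> y Ay; split=> [|yx]; [exact: subA | apply: nAx; rewrite -yx].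
split=> [|y z [Sy yx] [Sz zx]].
  by split=> // /eqP; rewrite eq_sym (negPf x_neq0).
split=> [|/= yzx]; first exact: SD.
have [y0|z0] := x_irr y z Sy Sz (esym yzx).
  by apply: zx; rewrite -yzx y0.
by apply: yx; rewrite -yzx z0 addn0.
Qed.

Lemma atoms_generate : submonoid S -> generates atom S.
Proof.
move=> monS; apply/seteqP; split=> [x|x Sx M [[M0 MD] subM]].
  by apply; split=> // y [].
have [k] := ubnP x; elim: k => // k IHk in x Sx *; rewrite ltnS => le_xk.
have [->//|x_neq0] := eqVneq x 0.
have [/subM//|] := pselect (atom x).
move=> /not_and3P[] // => /existsNP[y /existsNP[z]].
move=> /not_implyP[Sy /not_implyP[Sz /not_implyP[xE /not_orP[y0 z0]]]].
by rewrite xE; apply: MD; apply: IHk => //; lia.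
Qed.

(** The atoms generate [S] and belong to every generating set: a submonoid of the
    natural numbers has a single minimal generating set, and it avoids 0. *)
Lemma minimal_generating_set_atoms A :
  minimal_generating_set A S -> A = atom.
Proof.
move=> [genA minA]; symmetry; apply: minA.
  by move=> x; exact: atom_in_generating.
exact/atoms_generate/(generates_submonoid genA).
Qed.

Lemma minimal_generators_unique n m :
  minimal_generators S n -> minimal_generators S m -> n = m.
Proof.
move=> [sort_n /minimal_generating_set_atoms En].
move=> [sort_m /minimal_generating_set_atoms Em].
apply: (irr_sorted_eq ltn_trans ltnn) => // x.
have E : [set` n] x = [set` m] x by rewrite En Em.
by apply/idP/idP; rewrite -[is_true (x \in n)]/([set` n] x) E.
Qed.

End Atoms.

Definition lengths3 (n1 n2 n3 y : nat) : set nat :=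
  [set l | exists a b c, a * n1 + b * n2 + c * n3 = y /\ a + b + c = l].

Definition is_gap (n1 n2 n3 k : nat) : Prop :=
  exists y, gaps (lengths3 n1 n2 n3 y) k.

Lemma gap_intro (n1 n2 n3 y l l' : nat) :
  lengths3 n1 n2 n3 y l -> lengths3 n1 n2 n3 y l' -> l < l' ->
  (forall a b c, a * n1 + b * n2 + c * n3 = y ->
     l < a + b + c -> a + b + c < l' -> False) ->
  is_gap n1 n2 n3 (l' - l).
Proof.
move=> Ll Ll' lt_ll' none; exists y, l, l'; split=> // m [a [b [c [E <-]]]].
by apply/negP => /andP[]; exact: none E.
Qed.

Lemma gap_elim (n1 n2 n3 k : nat) : is_gap n1 n2 n3 k ->
  exists a b c a' b' c',
  [/\ a * n1 + b * n2 + c * n3 = a' * n1 + b' * n2 + c' * n3,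
      a' + b' + c' = a + b + c + k, 0 < k &
      forall x y z, x * n1 + y * n2 + z * n3 = a * n1 + b * n2 + c * n3 ->
        a + b + c < x + y + z -> a + b + c + k <= x + y + z].
Proof.
case=> y [_ [_ [[a [b [c [Ey <-]]]] [a' [b' [c' [Ey' <-]]]] lt_ll' none ->]]].
exists a, b, c, a', b', c'; split; [by rewrite Ey | by lia | by lia |].
move=> u v w; rewrite Ey => Eu lt_l; rewrite subnKC ?(ltnW lt_ll') //.
rewrite leqNgt; apply/negP => lt_l'.
have /none : lengths3 n1 n2 n3 y (u + v + w) by exists u, v, w.
by rewrite lt_l lt_l'.
Qed.

Lemma generates_three (n1 n2 n3 : nat) :
  generates [set` [:: n1; n2; n3]]
    [set y | exists a b c, a * n1 + b * n2 + c * n3 = y].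
Proof.
apply/seteqP; split=> y.
  apply; split.
    split; first by exists 0, 0, 0.
    move=> _ _ [a [b [c <-]]] [a' [b' [c' <-]]].
    by exists (a + a'), (b + b'), (c + c'); lia.
  move=> x /=; rewrite !inE => /or3P[] /eqP->.
  - by exists 1, 0, 0; lia.
  - by exists 0, 1, 0; lia.
  - by exists 0, 0, 1; lia.
move=> [a [b [c <-]]] M [monM subM]; have [M0 MD] := monM.
have MX k x : M x -> M (k * x).
  by move=> Mx; elim: k => // k IHk; rewrite mulSn; exact: MD.
by apply: (MD); [apply: (MD)|]; apply/MX/subM; rewrite /= !inE eqxx ?orbT.
Qed.

Lemma lengths_three (n1 n2 n3 y : nat) :
  lengths [:: n1; n2; n3] y = lengths3 n1 n2 n3 y.
Proof.
apply/seteqP; split=> l.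
  move=> [a]; rewrite /factorizations /= !big_ord_recl !big_ord0 /= => E <-.
  by eexists _, _, _; rewrite -E; split; rewrite ?addn0 !addnA.
move=> [a [b [c [<- <-]]]]; exists [tuple a; b; c].
  by rewrite /factorizations /= !big_ord_recl big_ord0 addn0 !addnA.
by rewrite !big_ord_recl big_ord0 addn0 !addnA.
Qed.

Lemma delta_set_three (S : set nat) (n1 n2 n3 : nat) :
  minimal_generators S [:: n1; n2; n3] ->
  delta_set S = is_gap n1 n2 n3.
Proof.
move=> minS; apply/seteqP; split=> k.
  move=> [n /(minimal_generators_unique minS) <- [y _]].
  by rewrite lengths_three; exists y.
move=> [y gap_y]; exists [:: n1; n2; n3] => //; exists y; last first.
  by rewrite lengths_three.
have [_ [genS _]] := minS; rewrite -genS generates_three.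
by case: gap_y => l [_ [[a [b [c [<- _]]]] _ _ _ _]]; exists a, b, c.
Qed.

Lemma minimal_generators_three_gt0 (S : set nat) (n1 n2 n3 : nat) :
  minimal_generators S [:: n1; n2; n3] -> [/\ 0 < n1, n1 < n2 & n2 < n3].
Proof.
move=> [/= /and3P[lt12 lt23 _] /minimal_generating_set_atoms E]; split=> //.
have : [set` [:: n1; n2; n3]] n1 by rewrite /= mem_head.
by rewrite E => -[_ n1_neq0 _]; rewrite lt0n.
Qed.

(** Minimality is stated over the integers because the candidates that it is
    applied to are coordinates of elements of the relation lattice. *)
Definition least_multiple (p q r c : nat) : Prop :=
  [/\ 0 < c, exists a b, c * p = a * q + b * r &
      forall x y z : int, (0 < x -> 0 <= y -> 0 <= z ->
        x * p%:Z = y * q%:Z + z * r%:Z -> c%:Z <= x)%R].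

Lemma least_multiple_exists (p q r : nat) :
  0 < q -> exists c, least_multiple p q r c.
Proof.
move=> q_gt0.
pose P c := `[< 0 < c /\ exists a b, c * p = a * q + b * r >].
have exP : exists c, P c.
  by exists q; apply/asboolP; split=> //; exists p, 0; lia.
case: (ex_minnP exP) => c /asboolP[c_gt0 rep] c_min; exists c; split=> // x y z.
move=> x_gt0 y_ge0 z_ge0 E.
have /c_min : P `|x|%N; last by lia.
by apply/asboolP; split; first lia; exists `|y|%N, `|z|%N; nia.
Qed.

Lemma combination_ge (c r x y : int) :
  (0 <= r <= c -> 0 < x -> 0 < x + y -> c <= x * c + y * r)%R.
Proof.
move=> /andP[r_ge0 le_rc] x_gt0 xy_gt0.
have -> : (x * c + y * r = c + ((x - 1) * (c - r) + (x + y - 1) * r))%R by lia.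
by rewrite lerDl addr_ge0 // mulr_ge0 //; lia.
Qed.

(** * The two extremal relations *)

Section Triple.

Variables n1 n2 n3 : nat.
Hypotheses (n1_gt0 : 0 < n1) (n12 : n1 < n2) (n23 : n2 < n3).

Definition longest_relation (c1 r2 r3 : nat) : Prop :=
  [/\ least_multiple n1 n2 n3 c1, c1 * n1 = r2 * n2 + r3 * n3 &
      forall a b, c1 * n1 = a * n2 + b * n3 -> a + b <= r2 + r3].

Definition shortest_relation (c3 r1 r2 : nat) : Prop :=
  [/\ least_multiple n3 n1 n2 c3, c3 * n3 = r1 * n1 + r2 * n2 &
      forall a b, c3 * n3 = a * n1 + b * n2 -> r1 + r2 <= a + b].

Lemma longest_relation_exists : exists c1 r2 r3, longest_relation c1 r2 r3.
Proof.
have [|c cP] := @least_multiple_exists n1 n2 n3; first lia.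
have [c_gt0 [a [b E]] _] := cP.
pose P m := `[< exists a b, c * n1 = a * n2 + b * n3 /\ a + b = m >].
have exP : exists m, P m by exists (a + b); apply/asboolP; exists a, b.
have ubP m : P m -> m <= c * n1 by move/asboolP => [u [v [Euv <-]]]; nia.
case: (ex_maxnP exP ubP) => _ /asboolP[u [v [Euv <-]]] maxP.
exists c, u, v; split=> // x y Exy.
by apply: maxP; apply/asboolP; exists x, y.
Qed.

Lemma shortest_relation_exists : exists c3 r1 r2, shortest_relation c3 r1 r2.
Proof.
have [//|c cP] := @least_multiple_exists n3 n1 n2.
have [c_gt0 [a [b E]] _] := cP.
pose P m := `[< exists a b, c * n3 = a * n1 + b * n2 /\ a + b = m >].
have exP : exists m, P m by exists (a + b); apply/asboolP; exists a, b.
case: (ex_minnP exP) => _ /asboolP[u [v [Euv <-]]] minP.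
exists c, u, v; split=> // x y Exy.
by apply: minP; apply/asboolP; exists x, y.
Qed.

Lemma longest_relation_gt c1 r2 r3 : longest_relation c1 r2 r3 -> r2 + r3 < c1.
Proof. by case=> -[c1_gt0 _ _] E _; nia. Qed.

Lemma shortest_relation_lt c3 r1 r2 :
  shortest_relation c3 r1 r2 -> c3 < r1 + r2.
Proof. by case=> -[c3_gt0 _ _] E _; nia. Qed.

(** A factorization of [c1 * n1] that uses both [n1] and another generator would
    give a smaller multiple of [n1] in <n2, n3>. *)
Lemma longest_relation_gap c1 r2 r3 :
  longest_relation c1 r2 r3 -> is_gap n1 n2 n3 (c1 - (r2 + r3)).
Proof.
move=> H; have lt_r := longest_relation_gt H; case: H => -[c1_gt0 _ minc] E maxr.
apply: (@gap_intro _ _ _ (c1 * n1)) => //.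
- by exists 0, r2, r3; split; lia.
- by exists c1, 0, 0; split; lia.
move=> a b c Eabc lt_l lt_l'.
have [a0|a_gt0] := posnP a; first by have := maxr b c; lia.
have lt_a : a < c1 by nia.
have := minc (c1%:Z - a%:Z)%R b c; nia.
Qed.

Lemma shortest_relation_gap c3 r1 r2 :
  shortest_relation c3 r1 r2 -> is_gap n1 n2 n3 (r1 + r2 - c3).
Proof.
move=> H; have lt_r := shortest_relation_lt H; case: H => -[c3_gt0 _ minc] E minr.
apply: (@gap_intro _ _ _ (c3 * n3)) => //.
- by exists 0, 0, c3; split; lia.
- by exists r1, r2, 0; split; lia.
move=> a b c Eabc lt_l lt_l'.
have [c0|c_gt0] := posnP c; first by have := minr a b; lia.
have lt_c : c < c3 by nia.
have := minc (c3%:Z - c%:Z)%R a b; nia.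
Qed.

Section Relations.

Variables c1 r12 r13 c3 r31 r32 : nat.
Hypotheses (rel1 : longest_relation c1 r12 r13).
Hypotheses (rel3 : shortest_relation c3 r31 r32).

(** If [r31 >= c1], replacing [c1] copies of [n1] in [r31 * n1 + r32 * n2] by
    [r12 * n2 + r13 * n3] shortens it.  This contradicts the choice of
    [r31 + r32] when [r13 = 0], and the minimality of [c3] otherwise, unless the
    two relations are the same.  The case [r13 >= c3] is symmetric. *)
Lemma relations_dichotomy :
  (r31 < c1 /\ r13 < c3) \/ [/\ r12 = 0, r13 = c3, r31 = c1 & r32 = 0].
Proof.
have lt1 := longest_relation_gt rel1; have lt3 := shortest_relation_lt rel3.
case: rel1 => -[c1_gt0 _ min1] E1 max1; case: rel3 => -[c3_gt0 _ min3] E3 min3'.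
have [lt_r31|le_r31] := ltnP r31 c1; have [lt_r13|le_r13] := ltnP r13 c3.
- by left.
- right; have [r31_0|r31_gt0] := posnP r31.
    by have := max1 (r12 + r32) (r13 - c3); nia.
  by have := min1 (c1%:Z - r31%:Z)%R (r12 + r32)%N (r13 - c3)%N; nia.
- right; have [r13_0|r13_gt0] := posnP r13.
    by have := min3' (r31 - c1) (r12 + r32); nia.
  by have := min3 (c3%:Z - r13%:Z)%R (r31 - c1)%N (r12 + r32)%N; nia.
by right; split; nia.
Qed.

(** ** The lattice when the relations are distinct *)

Section Basis.
Local Open Scope ring_scope.

Hypotheses (lt_r31 : (r31 < c1)%N) (lt_r13 : (r13 < c3)%N).

(* up to sign, the determinant of the first and third coordinates of v1, v3 *)
Let D : int := c1%:Z * c3%:Z - r13%:Z * r31%:Z.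

(** The point [(A / D) v1 + (B / D) v3] of the triangle (0, v1, v3) has first
    coordinate at most [c1] and third coordinate at least [- c3].  If its second
    coordinate is nonpositive it exhibits a multiple of [n1] in <n2, n3>, and
    otherwise a multiple of [n3] in <n1, n2>; minimality
    then forces a vertex, and [A, B < D] leave only 0. *)
Lemma no_relation_in_triangle (x1 x2 x3 A B : int) :
  x1 * n1%:Z + x2 * n2%:Z + x3 * n3%:Z = 0 ->
  D * x1 = A * c1%:Z + B * r31%:Z -> D * x3 = - A * r13%:Z - B * c3%:Z ->
  0 <= A < D -> 0 <= B < D -> A + B <= D -> A = 0 /\ B = 0.
Proof.
move=> rel Dx1 Dx3 /andP[A_ge0 lt_A] /andP[B_ge0 lt_B] le_AB.
case: rel1 => -[c1_gt0 _ min1] _ _; case: rel3 => -[c3_gt0 _ min3] _ _.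
have D_gt0 : 0 < D by lia.
have x1_ge0 : 0 <= x1 by rewrite -(pmulr_rge0 _ D_gt0) Dx1; nia.
have x3_le0 : x3 <= 0 by rewrite -(pmulr_rle0 _ D_gt0) Dx3; nia.
have zero : x1 = 0 -> x3 = 0 -> A = 0 /\ B = 0.
  by move=> x10 x30; move: Dx1 Dx3; rewrite x10 x30; split; nia.
have [x2_le0|x2_gt0] := lerP x2 0.
  have [x1_0|x1_neq0] := eqVneq x1 0; first by apply: zero => //; nia.
  have le_x1 : c1%:Z <= x1 by apply: (min1 _ (- x2) (- x3)); lia.
  suff : D * c1%:Z <= A * c1%:Z + B * r31%:Z by nia.
  by rewrite -Dx1 ler_pM2l.
have [x3_0|x3_neq0] := eqVneq x3 0; first by apply: zero => //; nia.
have le_x3 : c3%:Z <= - x3 by apply: (min3 _ x1 x2); lia.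
suff : D * c3%:Z <= A * r13%:Z + B * c3%:Z by nia.
by have := ler_pM2l D_gt0 c3%:Z (- x3); lia.
Qed.

(** Cramer's rule gives rational coordinates [A0 / D] and [B0 / D]; dropping their
    integral parts leaves a relation in the fundamental parallelogram, which up
    to the symmetry [y -> v1 + v3 - y] lies in the triangle. *)
Lemma relations_basis (x1 x2 x3 : int) :
  x1 * n1%:Z + x2 * n2%:Z + x3 * n3%:Z = 0 ->
  exists a b : int, [/\ x1 = a * c1%:Z + b * r31%:Z,
    x2 = b * r32%:Z - a * r12%:Z & x3 = - a * r13%:Z - b * c3%:Z].
Proof.
move=> rel.
case: (rel1) => -[c1_gt0 _ _] E1 _; case: (rel3) => -[c3_gt0 _ _] E3 _.
have D_gt0 : 0 < D by rewrite /D; nia.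
pose A0 := x1 * c3%:Z + x3 * r31%:Z; pose B0 := - (x1 * r13%:Z + x3 * c1%:Z).
pose a := (A0 %/ D)%Z; pose b := (B0 %/ D)%Z.
pose A := (A0 %% D)%Z; pose B := (B0 %% D)%Z.
have EA : A0 = a * D + A by exact: divz_eq.
have EB : B0 = b * D + B by exact: divz_eq.
have A_bd : 0 <= A < D by rewrite modz_ge0 ?ltz_pmod //; lia.
have B_bd : 0 <= B < D by rewrite modz_ge0 ?ltz_pmod //; lia.
pose y1 := x1 - (a * c1%:Z + b * r31%:Z).
pose y2 := x2 - (b * r32%:Z - a * r12%:Z).
pose y3 := x3 - (- a * r13%:Z - b * c3%:Z).
have rely : y1 * n1%:Z + y2 * n2%:Z + y3 * n3%:Z = 0.
  have E1' : c1%:Z * n1%:Z = r12%:Z * n2%:Z + r13%:Z * n3%:Z by lia.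
  have E3' : c3%:Z * n3%:Z = r31%:Z * n1%:Z + r32%:Z * n2%:Z by lia.
  transitivity (x1 * n1%:Z + x2 * n2%:Z + x3 * n3%:Z
    - a * (c1%:Z * n1%:Z - (r12%:Z * n2%:Z + r13%:Z * n3%:Z))
    + b * (c3%:Z * n3%:Z - (r31%:Z * n1%:Z + r32%:Z * n2%:Z))).
    by rewrite /y1 /y2 /y3; lia.
  by rewrite rel E1' E3' !subrr !mulr0 subr0 addr0.
have Dy1 : D * y1 = A * c1%:Z + B * r31%:Z.
  have -> : A = A0 - a * D by rewrite EA addrC addKr.
  have -> : B = B0 - b * D by rewrite EB addrC addKr.
  by rewrite /y1 /A0 /B0 /D; lia.
have Dy3 : D * y3 = - A * r13%:Z - B * c3%:Z.
  have -> : A = A0 - a * D by rewrite EA addrC addKr.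
  have -> : B = B0 - b * D by rewrite EB addrC addKr.
  by rewrite /y3 /A0 /B0 /D; lia.
have [A0' B0'] : A = 0 /\ B = 0.
  have [le_AB|gt_AB] := lerP (A + B) D.
    exact: (no_relation_in_triangle rely).
  have [] : D - A = 0 /\ D - B = 0; last lia.
  apply: (@no_relation_in_triangle (c1%:Z + r31%:Z - y1)
    (r32%:Z - r12%:Z - y2) (- r13%:Z - c3%:Z - y3)); lia.
have y1_0 : y1 = 0 by apply: (mulfI (lt0r_neq0 D_gt0)); rewrite Dy1 A0' B0'; lia.
have y3_0 : y3 = 0 by apply: (mulfI (lt0r_neq0 D_gt0)); rewrite Dy3 A0' B0'; lia.
have y2_0 : y2 = 0 by move: rely; rewrite y1_0 y3_0; nia.
by exists a, b; split; apply/subr0_eq.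
Qed.

End Basis.

Hypotheses (lt_r31 : r31 < c1) (lt_r13 : r13 < c3).

Lemma factorizations_basis a b c a' b' c' :
  a * n1 + b * n2 + c * n3 = a' * n1 + b' * n2 + c' * n3 ->
  exists x y : int, [/\ a'%:Z = a%:Z + x * c1%:Z + y * r31%:Z,
    b'%:Z = b%:Z + y * r32%:Z - x * r12%:Z &
    c'%:Z = c%:Z - x * r13%:Z - y * c3%:Z]%R.
Proof.
move=> E; have [|x [y [Ea Eb Ec]]] := @relations_basis lt_r31 lt_r13
  (a'%:Z - a%:Z)%R (b'%:Z - b%:Z)%R (c'%:Z - c%:Z)%R; first lia.
by exists x, y; split; lia.
Qed.

(** All lengths of relations are multiples of the common length.  If two
    factorizations differ by [x v1 + y v3] with [x + y > 0], then [v1] can be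
    subtracted from the longer one (when [x > 0]) or [v3] added to the shorter
    one (when [y > 0]), so consecutive lengths are one step apart. *)
Lemma equal_relation_gaps k :
  c1 + c3 = r12 + r13 + (r31 + r32) ->
  is_gap n1 n2 n3 k -> k = c1 - (r12 + r13).
Proof.
have lt1 := longest_relation_gt rel1; have lt3 := shortest_relation_lt rel3.
move=> eq_len /gap_elim[a [b [c [a' [b' [c' [E El k_gt0 next]]]]]]].
case: (rel1) => -[c1_gt0 _ _] E1 _; case: (rel3) => -[c3_gt0 _ _] E3 _.
have [x [y [Ea Eb Ec]]] := factorizations_basis E.
have Ek : (k%:Z = (x + y) * (c1%:Z - r12%:Z - r13%:Z))%R.
  have -> : ((x + y) * (c1%:Z - r12%:Z - r13%:Z) =
    x * (c1%:Z - r12%:Z - r13%:Z) + y * (r31%:Z + r32%:Z - c3%:Z))%R; last lia.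
  have -> : (r31%:Z + r32%:Z - c3%:Z = c1%:Z - r12%:Z - r13%:Z)%R by lia.
  lia.
have xy_gt0 : (0 < x + y)%R by nia.
have le_k : c1 - (r12 + r13) <= k.
  have : (1 * (c1%:Z - r12%:Z - r13%:Z) <= k%:Z)%R; last lia.
  by rewrite Ek ler_wpM2r; lia.
have [//|k_neq] := eqVneq k (c1 - (r12 + r13)).
have [x_gt0|x_le0] := ltrP 0%R x.
  have le_a' : c1 <= a' by have := @combination_ge c1 r31 x y; lia.
  suff : a + b + c + k <= a' - c1 + (b' + r12) + (c' + r13) by lia.
  apply: next; last lia.
  have : a' * n1 = (a' - c1) * n1 + c1 * n1 by rewrite -mulnDl subnK.
  by rewrite E1; lia.
have le_c : c3 <= c by have := @combination_ge c3 r13 y x; lia.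
suff : a + b + c + k <= a + r31 + (b + r32) + (c - c3) by lia.
apply: next; last lia.
have : c * n3 = (c - c3) * n3 + c3 * n3 by rewrite -mulnDl subnK.
by rewrite E3; lia.
Qed.

(** [v1 - v3] relates the factorizations [(0, r12 + r32, 0)] and
    [(c1 - r31, 0, c3 - r13)] of one element.  In the basis (v1, v3) any further
    factorization of this element is [(0, r12 + r32, 0)] plus a nonnegative
    multiple of [v1] or of [- v3], and its length lies outside the interval
    between the two.  The sum of the two truncated differences is the absolute
    value of the difference of the lengths. *)
Lemma middle_gap :
  c1 - (r12 + r13) <> r31 + r32 - c3 ->
  is_gap n1 n2 n3 ((c1 - (r12 + r13)) - (r31 + r32 - c3) +
                   ((r31 + r32 - c3) - (c1 - (r12 + r13)))).
Proof.
have lt1 := longest_relation_gt rel1; have lt3 := shortest_relation_lt rel3.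
case: (rel1) => -[c1_gt0 _ min1] E1 _; case: (rel3) => -[c3_gt0 _ min3] E3 _.
move=> neq.
have r12_gt0 : 0 < r12.
  rewrite lt0n; apply/eqP => r12_0.
  by have := min3 r13 c1 0; rewrite r12_0 in E1; nia.
have r32_gt0 : 0 < r32.
  rewrite lt0n; apply/eqP => r32_0.
  by have := min1 r31 0 c3; rewrite r32_0 in E3; nia.
have none a b c : a * n1 + b * n2 + c * n3 = (r12 + r32) * n2 ->
   [\/ a + b + c = r12 + r32, a + b + c = c1 - r31 + (c3 - r13),
     (a + b + c < r12 + r32) && (a + b + c < c1 - r31 + (c3 - r13)) |
     (a + b + c > r12 + r32) && (a + b + c > c1 - r31 + (c3 - r13))].
  move=> E; have [|x [y [Ea Eb Ec]]] :=
    @factorizations_basis 0 (r12 + r32) 0 a b c; first lia.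
  have y_le0 : (y <= 0)%R by rewrite leNgt; apply/negP => y_gt0; nia.
  have x_ge0 : (0 <= x)%R by rewrite leNgt; apply/negP => x_lt0; nia.
  have [y0|y_neq0] := eqVneq y 0%R.
    have [x0|x_neq0] := eqVneq x 0%R; first by constructor 1; nia.
    constructor 4; have : (0 < x * (c1%:Z - r12%:Z - r13%:Z))%R.
      by rewrite mulr_gt0; lia.
    have : (1 * (c1%:Z - r12%:Z - r13%:Z) <= x * (c1%:Z - r12%:Z - r13%:Z))%R.
      by rewrite ler_wpM2r; lia.
    by subst y; lia.
  have [x0|x_neq0] := eqVneq x 0%R.
    constructor 3; have : (1 * (r31%:Z + r32%:Z - c3%:Z) <=
                           - y * (r31%:Z + r32%:Z - c3%:Z))%R.
      by rewrite ler_wpM2r; lia.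
    by subst x; lia.
  have [x1 y1] : (x = 1 /\ y = -1)%R.
    have : (0 <= (x - 1) * r12%:Z /\ 0 <= (- y - 1) * r32%:Z)%R.
      by split; rewrite mulr_ge0; lia.
    have : ((x - 1) * r12%:Z + (- y - 1) * r32%:Z <= 0)%R by lia.
    have := mulf_eq0 (x - 1)%R r12%:Z; have := mulf_eq0 (- y - 1)%R r32%:Z.
    by split; lia.
  by constructor 2; subst x y; lia.
have L2 : lengths3 n1 n2 n3 ((r12 + r32) * n2) (r12 + r32).
  by exists 0, (r12 + r32), 0; split; lia.
have L13 : lengths3 n1 n2 n3 ((r12 + r32) * n2) (c1 - r31 + (c3 - r13)).
  by exists (c1 - r31), 0, (c3 - r13); split; nia.
have [lt_L|ge_L] := ltnP (r12 + r32) (c1 - r31 + (c3 - r13)).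
  have -> : (c1 - (r12 + r13)) - (r31 + r32 - c3) +
            ((r31 + r32 - c3) - (c1 - (r12 + r13))) =
            c1 - r31 + (c3 - r13) - (r12 + r32) by lia.
  by apply: (gap_intro L2 L13 lt_L) => a b c /none; case; lia.
have -> : (c1 - (r12 + r13)) - (r31 + r32 - c3) +
          ((r31 + r32 - c3) - (c1 - (r12 + r13))) =
          r12 + r32 - (c1 - r31 + (c3 - r13)) by lia.
by apply: (gap_intro L13 L2) => [|a b c /none]; [lia | case; lia].
Qed.

End Relations.

(** ** The case of a common least multiple of n1 and n3 *)

Section Coincident.

Variables c1 c3 : nat.
Hypothesis rel : longest_relation c1 0 c3.

(** Unless the exchange of [c1] copies of [n1] for [c3] copies of [n3] already
    produces a nearby length, the longer factorization has [a' < c1] and the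
    shorter one has [c < c3].  Adding [c1 * n1 = c3 * n3] to their difference
    and comparing sizes with [n1 < n2 < n3] then bounds the difference of the
    lengths. *)
Lemma coincident_gap_le k : is_gap n1 n2 n3 k -> k <= c1 - c3.
Proof.
have lt_c := longest_relation_gt rel.
case: (rel) => -[c1_gt0 _ _] Ec _.
move=> /gap_elim[a [b [c [a' [b' [c' [E El k_gt0 next]]]]]]].
have [le_a'|lt_a'] := leqP c1 a'.
  rewrite leqNgt; apply/negP => gt_k.
  suff : a + b + c + k <= a' - c1 + b' + (c' + c3) by lia.
  apply: next; last lia.
  have : a' * n1 = (a' - c1) * n1 + c1 * n1 by rewrite -mulnDl subnK.
  by rewrite Ec; lia.
have [le_c|lt_cc] := leqP c3 c.
  rewrite leqNgt; apply/negP => gt_k.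
  suff : a + b + c + k <= a + c1 + b + (c - c3) by lia.
  apply: next; last lia.
  have : c * n3 = (c - c3) * n3 + c3 * n3 by rewrite -mulnDl subnK.
  lia.
have [le_b|lt_b] := leqP b b'.
  suff : b' - b + (c' + c3 - c) <= c1 + a - a' by lia.
  rewrite -(leq_pmul2r n1_gt0).
  have : (b' - b) * n2 + (c' + c3 - c) * n3 = (c1 + a - a') * n1.
    by rewrite !mulnBl !mulnDl; nia.
  nia.
suff : c' + c3 - c <= c1 + a - a' + (b - b') by lia.
have : (c' + c3 - c) * n3 = (c1 + a - a') * n1 + (b - b') * n2.
  by rewrite !mulnBl !mulnDl; nia.
nia.
Qed.

Variables c2 A B : nat.
Hypotheses (min2 : least_multiple n2 n1 n3 c2).
Hypotheses (E2 : c2 * n2 = A * n1 + B * n3).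

(** After reduction modulo [c2] in the second coordinate and modulo [c1] in the
    first one, a relation reads [s * n1 = y2 * n2 + y3 * n3] with [s < c1] and
    [y2 < c2]; the minimality of [c1] or of [c2], according to the sign of [y3],
    makes it trivial. *)
Lemma coincident_basis (x1 x2 x3 : int) :
  (x1 * n1%:Z + x2 * n2%:Z + x3 * n3%:Z = 0 ->
  exists a b : int, [/\ x1 = a * c1%:Z - b * A%:Z,
    x2 = b * c2%:Z & x3 = - a * c3%:Z - b * B%:Z])%R.
Proof.
case: (rel) => -[c1_gt0 _ min1] Ec _; case: min2 => c2_gt0 _ minc2.
move=> relx; pose b := (x2 %/ c2)%Z; pose y2 := (x2 %% c2)%Z.
have Ex2 : (x2 = b * c2%:Z + y2)%R by exact: divz_eq.
have y2_bd : (0 <= y2 < c2%:Z)%R by rewrite modz_ge0 ?ltz_pmod //; lia.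
pose m := (- (x1 + b * A%:Z))%R.
pose k := (m %/ c1)%Z; pose s := (m %% c1)%Z.
have Em : (m = k * c1%:Z + s)%R by exact: divz_eq.
have s_bd : (0 <= s < c1%:Z)%R by rewrite modz_ge0 ?ltz_pmod //; lia.
pose y3 := (x3 + b * B%:Z - k * c3%:Z)%R.
have rely : (s * n1%:Z = y2 * n2%:Z + y3 * n3%:Z)%R.
  have E2' : (c2%:Z * n2%:Z = A%:Z * n1%:Z + B%:Z * n3%:Z)%R by lia.
  have Ec' : (c1%:Z * n1%:Z = c3%:Z * n3%:Z)%R by lia.
  have -> : s = (m - k * c1%:Z)%R by rewrite Em; lia.
  have -> : y2 = (x2 - b * c2%:Z)%R by rewrite Ex2; lia.
  have bE2 : (b * (c2%:Z * n2%:Z) = b * (A%:Z * n1%:Z + B%:Z * n3%:Z))%R.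
    by rewrite E2'.
  have kEc : (k * (c1%:Z * n1%:Z) = k * (c3%:Z * n3%:Z))%R by rewrite Ec'.
  by rewrite /m /y3; lia.
have [y3_ge0|y3_lt0] := lerP 0%R y3.
  have s0 : s = 0%R.
    have [//|s_neq0] := eqVneq s 0%R.
    by have := min1 s y2 y3; lia.
  have y20 : y2 = 0%R by rewrite s0 in rely; nia.
  have y30 : y3 = 0%R by rewrite s0 y20 in rely; nia.
  exists (- k)%R, b; split; rewrite ?Ex2; move: y30; rewrite /y3; lia.
have y2_gt0 : (0 < y2)%R by nia.
by have := minc2 y2 s (- y3)%R; lia.
Qed.

(** A factorization of [c1 * n1 + c2 * n2] that uses [n2] uses at least [c2]
    copies of it.  Removing them leaves a factorization of [c1 * n1], of length
    [c1] or at most [c3], so the length is not strictly between [c3 + c2] and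
    [c1 + c2].  The factorizations without [n2] differ by multiples of
    [(c1, 0, - c3)], so at most one of their lengths fits strictly between. *)
Lemma coincident_middle_length (u v : int) f1 f2 f3 :
  (u * n1%:Z + v * n3%:Z = c1%:Z * n1%:Z + c2%:Z * n2%:Z)%R ->
  (c3%:Z + c2%:Z < u + v < c1%:Z + c2%:Z)%R ->
  f1 * n1 + f2 * n2 + f3 * n3 = c1 * n1 + c2 * n2 ->
  c3 + c2 < f1 + f2 + f3 < c1 + c2 ->
  ((f1 + f2 + f3)%N%:Z = u + v)%R.
Proof.
have lt_c := longest_relation_gt rel.
case: (rel) => -[c1_gt0 _ min1] Ec maxc; case: (min2) => c2_gt0 _ _.
move=> Euv /andP[gt_uv lt_uv] Ef /andP[lt_l lt_l'].
have [|x [w [Ex1 Ex2 Ex3]]] := @coincident_basis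
  (f1%:Z - u)%R f2%:Z%R (f3%:Z - v)%R; first lia.
have [f20|f2_gt0] := posnP f2.
  have w0 : w = 0%R.
    by apply/eqP; have := mulf_eq0 w c2%:Z; rewrite -Ex2 f20; lia.
  have Lx : ((f1 + f2 + f3)%N%:Z = u + v + x * (c1%:Z - c3%:Z))%R.
    by subst w; lia.
  suff x0 : x = 0%R by rewrite x0 in Lx; lia.
  have [x_gt0|x_lt0|<- //] := ltgtP 0%R x.
    have : (1 * (c1%:Z - c3%:Z) <= x * (c1%:Z - c3%:Z))%R.
      by rewrite ler_wpM2r; lia.
    lia.
  have : (1 * (c1%:Z - c3%:Z) <= - x * (c1%:Z - c3%:Z))%R.
    by rewrite ler_wpM2r; lia.
  lia.
have le_f2 : c2 <= f2.
  have w_gt0 : (0 < w)%R by rewrite -(@pmulr_lgt0 _ c2%:Z) -?Ex2; lia.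
  have : (1 * c2%:Z <= w * c2%:Z)%R by rewrite ler_wpM2r; lia.
  lia.
have Ef' : c1 * n1 = f1 * n1 + (f2 - c2) * n2 + f3 * n3.
  have : f2 * n2 = (f2 - c2) * n2 + c2 * n2 by rewrite -mulnDl subnK.
  lia.
have [f10|f1_gt0] := posnP f1.
  by have := maxc (f2 - c2) f3; rewrite f10 in Ef' lt_l lt_l' *; lia.
have lt_f1 : f1 < c1.
  rewrite ltnNge; apply/negP => le_f1.
  have : f1 * n1 = (f1 - c1) * n1 + c1 * n1 by rewrite -mulnDl subnK.
  have := leq_pmulr (f1 - c1) n1_gt0.
  have : f2 - c2 <= (f2 - c2) * n2 by rewrite leq_pmulr //; lia.
  have : f3 <= f3 * n3 by rewrite leq_pmulr //; lia.
  lia.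
have := min1 (c1%:Z - f1%:Z)%R (f2 - c2)%N f3; lia.
Qed.

(** A gap that is not a multiple of [c1 - c3] forces the length [e] of the
    relation [(- A, c2, - B)] not to be one either, so some factorization
    [(u, 0, v)] of [c1 * n1 + c2 * n2] over the integers has length strictly
    between [c3 + c2] and [c1 + c2].  The order [n1 < n2 < n3] makes [u] and [v]
    nonnegative. *)
Lemma coincident_gap_split k : is_gap n1 n2 n3 k -> ~~ (c1 - c3 %| k) ->
  exists g h, [/\ is_gap n1 n2 n3 g, is_gap n1 n2 n3 h & g + h = c1 - c3].
Proof.
have lt_c := longest_relation_gt rel.
case: (rel) => -[c1_gt0 _ min1] Ec maxc; case: (min2) => c2_gt0 _ _.
pose D : int := (c1%:Z - c3%:Z)%R.
pose e : int := (c2%:Z - A%:Z - B%:Z)%R.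
move=> /gap_elim[a [b [c [a' [b' [c' [E El k_gt0 _]]]]]]] ndvd.
have ndvd_e : ~~ (D %| e)%Z.
  apply: contra ndvd => /dvdzP[q Eq].
  have [|x [y [Ea Eb Ecc]]] := @coincident_basis
    (a'%:Z - a%:Z)%R (b'%:Z - b%:Z)%R (c'%:Z - c%:Z)%R; first lia.
  have : (D %| k%:Z)%Z.
    apply/dvdzP; exists (x + y * q)%R.
    have yq : (y * e = y * (q * D))%R by rewrite Eq.
    by move: yq; rewrite /e /D; lia.
  by rewrite dvdzE /=; have -> : `|D|%N = c1 - c3 by rewrite /D; lia.
pose q := (e %/ D)%Z; pose r := (e %% D)%Z.
have D_gt0 : (0 < D)%R by rewrite /D; lia.
have Eqr : (e = q * D + r)%R by exact: divz_eq.
have r_bd : (0 < r < D)%R.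
  have r_neq0 : r != 0%R.
    by apply: contra ndvd_e => /eqP r0; apply/dvdz_mod0P.
  by rewrite lt_def r_neq0 modz_ge0 ?ltz_pmod ?gt_eqF.
(* the factorization (u, 0, v) is the one strictly between the other two *)
pose u : int := (A%:Z + (q + 1) * c1%:Z)%R.
pose v : int := (B%:Z - q * c3%:Z)%R.
have Euv : (u * n1%:Z + v * n3%:Z = c1%:Z * n1%:Z + c2%:Z * n2%:Z)%R.
  have : (q * (c1%:Z * n1%:Z) = q * (c3%:Z * n3%:Z))%R by congr (_ * _)%R; lia.
  by rewrite /u /v; lia.
have Luv : (u + v = c1%:Z + c2%:Z - r)%R by rewrite /u /v /e /D in Eqr *; lia.
have u_ge0 : (0 <= u)%R.
  rewrite leNgt; apply/negP => u_lt0.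
  have un : (- u * n1%:Z <= - u * n3%:Z)%R by rewrite ler_wpM2l; lia.
  have cn : (c2%:Z * n2%:Z <= c2%:Z * n3%:Z)%R by rewrite ler_wpM2l; lia.
  have : (v <= c3%:Z + c2%:Z - u)%R.
    by rewrite -(@ler_pM2r _ n3%:Z); lia.
  by rewrite /D in r_bd; lia.
have v_ge0 : (0 <= v)%R.
  rewrite leNgt; apply/negP => v_lt0.
  have vn : (- v * n1%:Z <= - v * n3%:Z)%R by rewrite ler_wpM2l; lia.
  have cn : (c2%:Z * n1%:Z <= c2%:Z * n2%:Z)%R by rewrite ler_wpM2l; lia.
  have : (c1%:Z + c2%:Z - v <= u)%R.
    by rewrite -(@ler_pM2r _ n1%:Z); lia.
  lia.
pose y := c1 * n1 + c2 * n2; pose l := `|(u + v)%R|%N.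
have Ll : lengths3 n1 n2 n3 y l.
  by exists `|u|%N, 0, `|v|%N; split; rewrite /y /l; lia.
have L1 : lengths3 n1 n2 n3 y (c1 + c2) by exists c1, c2, 0; split; lia.
have L3 : lengths3 n1 n2 n3 y (c3 + c2) by exists 0, c2, c3; split; lia.
have none f1 f2 f3 : f1 * n1 + f2 * n2 + f3 * n3 = y ->
    c3 + c2 < f1 + f2 + f3 -> f1 + f2 + f3 < c1 + c2 -> f1 + f2 + f3 = l.
  move=> Ef lt_l lt_l'.
  have := @coincident_middle_length u v f1 f2 f3 Euv _ Ef; rewrite lt_l lt_l'.
  by rewrite /D in r_bd; lia.
have bd : c3 + c2 < l < c1 + c2 by rewrite /D in r_bd; lia.
case/andP: bd => lt_l lt_l'.
exists (l - (c3 + c2)), (c1 + c2 - l); split; last lia.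
  apply: (gap_intro L3 Ll lt_l) => f1 f2 f3 Ef; have := none _ _ _ Ef; lia.
apply: (gap_intro Ll L1 lt_l') => f1 f2 f3 Ef; have := none _ _ _ Ef; lia.
Qed.

End Coincident.

Theorem two_gaps_ratio (d t : nat) : 0 < d -> 2 <= t ->
  (forall k, is_gap n1 n2 n3 k <-> k = d \/ k = t * d) -> t = 2.
Proof.
move=> d_gt0 t_ge2 gapE.
have gap_d : is_gap n1 n2 n3 d by apply/gapE; left.
have gap_td : is_gap n1 n2 n3 (t * d) by apply/gapE; right.
have lt_td : d < t * d by nia.
have [c1 [r12 [r13 rel1]]] := longest_relation_exists.
have [c3 [r31 [r32 rel3]]] := shortest_relation_exists.
have lt1 := longest_relation_gt rel1; have lt3 := shortest_relation_lt rel3.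
have /gapE gap1 := longest_relation_gap rel1.
have /gapE gap3 := shortest_relation_gap rel3.
case: (relations_dichotomy rel1 rel3) => [[lt_r31 lt_r13]|[r12_0 r13E _ _]].
  have [eq_len|neq_len] := eqVneq (c1 - (r12 + r13)) (r31 + r32 - c3).
    have all_gaps := equal_relation_gaps rel1 rel3 lt_r31 lt_r13.
    have eq_sum : c1 + c3 = r12 + r13 + (r31 + r32) by lia.
    by have := all_gaps _ eq_sum gap_d; have := all_gaps _ eq_sum gap_td; lia.
  have /gapE := middle_gap rel1 rel3 lt_r31 lt_r13 (elimN eqP neq_len).
  by nia.
move: rel1 gap1 lt1; rewrite {}r12_0 {}r13E => rel gap1 lt1.
have [|c2 min2] := @least_multiple_exists n2 n1 n3; first by [].
have [c2_gt0 [A [B E2]] _] := min2.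
have le_td := coincident_gap_le rel gap_td.
have [|g [h [/gapE gap_g /gapE gap_h]]] :=
  coincident_gap_split rel min2 E2 gap_d; last nia.
by apply/negP => /(dvdn_leq d_gt0); lia.
Qed.

End Triple.

(** * Semigroups from pairwise coprime triples *)

Lemma coprime_representation (m n N : nat) : 0 < m -> 0 < n -> coprime m n ->
  m * n <= N -> exists a b, N = a * m + b * n.
Proof.
move=> m_gt0 n_gt0 co_mn le_N.
pose x := chinese m n 0 N %% (m * n).
have lt_x : x < m * n by rewrite ltn_mod muln_gt0 m_gt0.
have /dvdnP[a Ea] : m %| x.
  by rewrite /dvdn modn_dvdm ?dvdn_mulr // chinese_modl // mod0n.
have /dvdnP[b Eb] : n %| N - x.
  rewrite -eqn_mod_dvd; last lia.
  by rewrite modn_dvdm ?dvdn_mull // chinese_modr.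
by exists a, b; rewrite -Ea -Eb; lia.
Qed.

(** A coordinate that starts in [0, c[ can only become nonnegative again after a
    nonnegative number of exchanges of [c] copies. *)
Lemma shift_ge0 (x u c : int) :
  (0 <= u < c -> 0 <= u + x * c -> 0 <= x)%R.
Proof.
move=> /andP[u_ge0 lt_uc] shift_ge; rewrite leNgt; apply/negP => x_lt0.
have : (1 * c <= - x * c)%R by rewrite ler_wpM2r; lia.
lia.
Qed.

Section CoprimeTriple.

Variables c1 c2 c3 : nat.
Hypotheses (c3_gt1 : 1 < c3) (lt32 : c3 < c2) (lt21 : c2 < c1).
Hypotheses (co12 : coprime c1 c2) (co13 : coprime c1 c3) (co23 : coprime c2 c3).

Let n1 := c2 * c3.
Let n2 := c1 * c3.
Let n3 := c1 * c2.

Definition coprime_triple_semigroup : set nat :=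
  [set y | exists a b c, a * n1 + b * n2 + c * n3 = y].
Local Notation S := coprime_triple_semigroup.

(** A large integer is [a c1 + b (c2 c3)] with [a >= c2 c3], and then [a] is a
    combination of [c2] and [c3]. *)
Lemma coprime_triple_numerical : numerical_semigroup S.
Proof.
split; first exact: generates_submonoid (generates_three n1 n2 n3).
apply: (@sub_finite_set _ _ `I_(c1 * (c2 * c3) + c1 * (c2 * c3))).
  move=> N /= nSN; rewrite ltnNge; apply/negP => le_N; apply: nSN.
  have co1 : coprime c1 (c2 * c3) by rewrite coprimeMr co12.
  have c23_gt0 : 0 < c2 * c3 by rewrite muln_gt0; lia.
  have [||a [b Eab]] := @coprime_representation c1 (c2 * c3)
    (N - c1 * (c2 * c3)) _ c23_gt0 co1; [lia | lia |].
  have [|||u [v Euv]] := @coprime_representation c2 c3 (a + c2 * c3) _ _ co23;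
    [lia | lia | lia |].
  exists b, v, u; rewrite /n1 /n2 /n3.
  have -> : N = (a + c2 * c3) * c1 + b * (c2 * c3) by lia.
  by rewrite Euv; lia.
exact: finite_II.
Qed.

(** Modulo [c1] only the first term of a relation survives, and [c2 * c3] is
    invertible there; likewise for the other two coordinates. *)
Lemma coprime_triple_basis (a b c a' b' c' : nat) :
  a * n1 + b * n2 + c * n3 = a' * n1 + b' * n2 + c' * n3 ->
  exists x y z : int, [/\ x + y + z = 0, a'%:Z = a%:Z + x * c1%:Z,
    b'%:Z = b%:Z + y * c2%:Z & c'%:Z = c%:Z + z * c3%:Z]%R.
Proof.
rewrite /n1 /n2 /n3 => E.
have cong (p q r u v : nat) : coprime p q -> coprime p r ->
    forall w : int, (w * p%:Z = (v%:Z - u%:Z) * (q * r)%N%:Z)%R ->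
    exists x : int, (v%:Z = u%:Z + x * p%:Z)%R.
  move=> co_pq co_pr w Ew.
  have /dvdzP[x Ex] : (p%:Z %| (v%:Z - u%:Z)%R)%Z.
    rewrite -(@Gauss_dvdzl _ _ (q * r)%N%:Z); first by apply/dvdzP; exists w.
    by rewrite coprimezE /= coprimeMr co_pq.
  by exists x; rewrite -Ex; lia.
have [x Ex] : exists x : int, (a'%:Z = a%:Z + x * c1%:Z)%R.
  apply: (cong c1 c2 c3 a a' co12 co13
    ((b%:Z - b'%:Z) * c3%:Z + (c%:Z - c'%:Z) * c2%:Z)%R); lia.
have [y Ey] : exists y : int, (b'%:Z = b%:Z + y * c2%:Z)%R.
  apply: (cong c2 c1 c3 b b' _ co23
    ((a%:Z - a'%:Z) * c3%:Z + (c%:Z - c'%:Z) * c1%:Z)%R);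
    rewrite 1?coprime_sym //; lia.
have [z Ez] : exists z : int, (c'%:Z = c%:Z + z * c3%:Z)%R.
  apply: (cong c3 c1 c2 c c' _ _
    ((a%:Z - a'%:Z) * c2%:Z + (b%:Z - b'%:Z) * c1%:Z)%R);
    rewrite 1?coprime_sym //; lia.
exists x, y, z; split=> //.
have : ((x + y + z) * (c1%:Z * c2%:Z * c3%:Z) = 0)%R.
  have : (a'%:Z * (c2%:Z * c3%:Z) + b'%:Z * (c1%:Z * c3%:Z) +
          c'%:Z * (c1%:Z * c2%:Z) =
          a%:Z * (c2%:Z * c3%:Z) + b%:Z * (c1%:Z * c3%:Z) +
          c%:Z * (c1%:Z * c2%:Z))%R by lia.
  by rewrite Ex Ey Ez; lia.
by move/eqP; rewrite mulf_eq0 => /orP[/eqP//|]; rewrite !mulf_eq0; lia.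
Qed.

Lemma coprime_triple_generators : minimal_generators S [:: n1; n2; n3].
Proof.
have genS : generates [set` [:: n1; n2; n3]] S := generates_three n1 n2 n3.
split; first by rewrite /= /n1 /n2 /n3 andbT; apply/andP; split; nia.
split=> // B subB genB; apply/seteqP; split=> // x.
have irr f1 f2 f3 : (f1 + f2 + f3 = 1) -> atom S (f1 * n1 + f2 * n2 + f3 * n3).
  move=> f_sum; split; first by exists f1, f2, f3.
    by rewrite -lt0n /n1 /n2 /n3; nia.
  move=> _ _ [a [b [c <-]]] [a' [b' [c' <-]]] E.
  have [|x1 [x2 [x3 [sum0 E1 E2 E3]]]] :=
    @coprime_triple_basis f1 f2 f3 (a + a') (b + b') (c + c'); first lia.
  have x1_ge0 : (0 <= x1)%R by apply: (@shift_ge0 _ f1%:Z c1%:Z); lia.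
  have x2_ge0 : (0 <= x2)%R by apply: (@shift_ge0 _ f2%:Z c2%:Z); lia.
  have x3_ge0 : (0 <= x3)%R by apply: (@shift_ge0 _ f3%:Z c3%:Z); lia.
  have [x10 x20 x30] : [/\ x1 = 0, x2 = 0 & x3 = 0]%R by split; lia.
  have [sum0'|sum0'] : a + b + c = 0 \/ a' + b' + c' = 0 by subst; lia.
    by left; have [-> -> ->] : [/\ a = 0, b = 0 & c = 0] by split; lia.
  by right; have [-> -> ->] : [/\ a' = 0, b' = 0 & c' = 0] by split; lia.
rewrite /= !inE => /or3P[] /eqP->; apply: (atom_in_generating genB).
- by have := irr 1 0 0 erefl; rewrite mul1n !mul0n !addn0.
- by have := irr 0 1 0 erefl; rewrite mul1n !mul0n !addn0.
- by have := irr 0 0 1 erefl; rewrite mul1n !mul0n.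
Qed.

(** A factorization with [b >= c2] or [c >= c3] can be lengthened by [c1 - c2] or
    by [c2 - c3]; when neither holds it is the longest one. *)
Lemma coprime_triple_gap_le k :
  is_gap n1 n2 n3 k -> k <= maxn (c1 - c2) (c2 - c3).
Proof.
move=> /gap_elim[a [b [c [a' [b' [c' [E El k_gt0 next]]]]]]].
rewrite leqNgt; apply/negP => gt_k.
have [le_b|lt_b] := leqP c2 b.
  suff : a + b + c + k <= a + c1 + (b - c2) + c by lia.
  apply: next; last lia.
  have : b * n2 = (b - c2) * n2 + c2 * n2 by rewrite -mulnDl subnK.
  by rewrite /n1 /n2 /n3; lia.
have [le_c|lt_c] := leqP c3 c.
  suff : a + b + c + k <= a + (b + c2) + (c - c3) by lia.
  apply: next; last lia.
  have : c * n3 = (c - c3) * n3 + c3 * n3 by rewrite -mulnDl subnK.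
  by rewrite /n1 /n2 /n3; lia.
have [x [y [z [sum0 Ea Eb Ec]]]] := coprime_triple_basis E.
have y_ge0 : (0 <= y)%R by apply: (@shift_ge0 _ b%:Z c2%:Z); lia.
have z_ge0 : (0 <= z)%R by apply: (@shift_ge0 _ c%:Z c3%:Z); lia.
have xE : (x = - y - z)%R by lia.
have : (0 <= y * (c1%:Z - c2%:Z))%R by rewrite mulr_ge0; lia.
have : (0 <= z * (c1%:Z - c3%:Z))%R by rewrite mulr_ge0; lia.
subst x; lia.
Qed.

Lemma coprime_triple_gap_dvd d k : d %| c1 - c2 -> d %| c2 - c3 ->
  is_gap n1 n2 n3 k -> d %| k.
Proof.
move=> /dvdnP[p Ep] /dvdnP[q Eq].
move=> /gap_elim[a [b [c [a' [b' [c' [E El k_gt0 _]]]]]]].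
have [x [y [z [sum0 Ea Eb Ec]]]] := coprime_triple_basis E.
have : (d%:Z %| k%:Z)%Z; last by rewrite dvdzE.
apply/dvdzP; exists (x * p%:Z - z * q%:Z)%R.
have Ep' : (c1%:Z = c2%:Z + p%:Z * d%:Z)%R by lia.
have Eq' : (c3%:Z = c2%:Z - q%:Z * d%:Z)%R by lia.
have xE : (y = - x - z)%R by lia.
subst y; rewrite Ep' in Ea; rewrite Eq' in Ec; lia.
Qed.

(** The element [c1 * c2 * c3] has exactly three factorizations, one for each
    generator. *)
Lemma coprime_triple_gaps :
  is_gap n1 n2 n3 (c1 - c2) /\ is_gap n1 n2 n3 (c2 - c3).
Proof.
pose y := c1 * (c2 * c3).
have none a b c : a * n1 + b * n2 + c * n3 = y ->
    [\/ a + b + c = c1, a + b + c = c2 | a + b + c = c3].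
  move=> E; have [|x1 [x2 [x3 [sum0 E1 E2 E3]]]] :=
    @coprime_triple_basis c1 0 0 a b c; first by rewrite E /n1 /y; lia.
  have x1_ge : (0 <= x1 + 1)%R by apply: (@shift_ge0 _ 0%R c1%:Z); lia.
  have x2_ge0 : (0 <= x2)%R by apply: (@shift_ge0 _ 0%R c2%:Z); lia.
  have x3_ge0 : (0 <= x3)%R by apply: (@shift_ge0 _ 0%R c3%:Z); lia.
  have [x10|x1_neq0] := eqVneq x1 0%R.
    have [x20 x30] : (x2 = 0 /\ x3 = 0)%R by lia.
    by constructor 1; subst; lia.
  have x1E : (x1 = -1)%R by lia.
  have [x20|x2_neq0] := eqVneq x2 0%R.
    have x3E : (x3 = 1)%R by lia.
    by constructor 3; subst; lia.
  have [x2E x30] : (x2 = 1 /\ x3 = 0)%R by lia.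
  by constructor 2; subst; lia.
have L1 : lengths3 n1 n2 n3 y c1 by exists c1, 0, 0; rewrite /n1 /y; lia.
have L2 : lengths3 n1 n2 n3 y c2 by exists 0, c2, 0; rewrite /n2 /y; lia.
have L3 : lengths3 n1 n2 n3 y c3 by exists 0, 0, c3; rewrite /n3 /y; lia.
split; first by apply: (gap_intro L2 L1 lt21) => a b c /none; case; lia.
by apply: (gap_intro L3 L2 lt32) => a b c /none; case; lia.
Qed.

End CoprimeTriple.

Theorem mainTheorem2 (d t : nat) (hd : 1 <= d) (ht : 2 <= t) :
  (exists S : set nat, [/\ numerical_semigroup S, embedding_dimension S 3 &
                           delta_set S = [set d; t * d]]) <-> t = 2.
Proof.
split=> [[S [_ [n minS size_n] deltaS]]|->].
  case: n => [|n1 [|n2 [|n3 [|? ?]]]] // in minS size_n *.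
  have [n1_gt0 n12 n23] := minimal_generators_three_gt0 minS.
  apply: (two_gaps_ratio n1_gt0 n12 n23 hd ht) => k.
  by rewrite -(delta_set_three minS) deltaS.
(* one step of Euclid's algorithm *)
have co_step (a b q r : nat) : a = q * b + r -> coprime b r -> coprime a b.
  by move=> -> co_br; rewrite coprime_sym /coprime gcdnMDl.
have co12 : coprime (6 * d + 1) (4 * d + 1).
  apply: (co_step _ _ 1 (2 * d)); first lia.
  by apply: (co_step _ _ 2 1); [lia | rewrite coprimen1].
have co13 : coprime (6 * d + 1) (3 * d + 1).
  apply: (co_step _ _ 1 (3 * d)); first lia.
  by apply: (co_step _ _ 1 1); [lia | rewrite coprimen1].
have co23 : coprime (4 * d + 1) (3 * d + 1).
  apply: (co_step _ _ 1 d); first lia.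
  by apply: (co_step _ _ 3 1); [lia | rewrite coprimen1].
have c3_gt1 : 1 < 3 * d + 1 by lia.
have lt32 : 3 * d + 1 < 4 * d + 1 by lia.
have lt21 : 4 * d + 1 < 6 * d + 1 by lia.
have gens := coprime_triple_generators c3_gt1 lt32 lt21 co12 co13 co23.
eexists; split; first exact: coprime_triple_numerical co12 co13 co23.
  by eexists; first exact: gens.
rewrite (delta_set_three gens); apply/seteqP; split=> k /=.
  move=> gap_k; have := gap_k.
  move=> /(coprime_triple_gap_le c3_gt1 lt32 lt21 co12 co13 co23) le_k.
  have /dvdnP[m km] : d %| k.
    apply: (coprime_triple_gap_dvd c3_gt1 lt32 lt21 co12 co13 co23) gap_k.
      by apply/dvdnP; exists 2; lia.
    by apply/dvdnP; exists 1; lia.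
  have [a [b [c [a' [b' [c' [_ _ k_gt0 _]]]]]]] := gap_elim gap_k.
  have [m1|m2] : m = 1 \/ m = 2 by nia.
    by left; rewrite km m1 mul1n.
  by right; rewrite km m2.
have [gap_2d gap_d] :=
  coprime_triple_gaps c3_gt1 lt32 lt21 co12 co13 co23.
case=> ->.
  by move: gap_d; have -> : 4 * d + 1 - (3 * d + 1) = d by lia.
by move: gap_2d; have -> : 6 * d + 1 - (4 * d + 1) = 2 * d by lia.
Qed.
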